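(* For every tree $\Upsilon$ there is a $C^\infty$ bump function on $C_0(\Upsilon)$, i.e. a non-zero infinitely Fréchet differentiable function $C_0(\Upsilon)\to\mathbb{R}$ with bounded support.
   Context: A tree is a partially ordered set $(\Upsilon,\preceq)$ such that for each $t\in\Upsilon$ the set $\{s: s\preceq t\}$ is well-ordered by $\preceq$; write $(0,t]=\{s:s\preceq t\}$, $(0,t)=\{s:s\prec t\}$, and let $r(t)$ be the order type of $(0,t)$. Trees are assumed Hausdorff: if $r(t)$ is a limit ordinal and $(0,t)=(0,t')$ then $t=t'$. $\Upsilon$ carries the coarsest topology in which every $(0,t]$ is open and closed. $C_0(\Upsilon)$ is the Banach space of continuous $f:\Upsilon\to\mathbb{R}$ such that $\{t:|f(t)|\ge\epsilon\}$ is compact for all $\epsilon>0$, with the supremum norm. *)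

(* Defs.v *)
From HB Require Import structures.
From mathcomp Require Import all_boot all_order all_algebra.
From mathcomp Require Import all_classical all_reals all_analysis.

Set Implicit Arguments.
Unset Strict Implicit.
Unset Printing Implicit Defensive.

Import Order.TTheory GRing.Theory Num.Theory.
Local Open Scope classical_set_scope.
Local Open Scope ring_scope.

Definition tlt (T : Type) (le : T -> T -> Prop) (s t : T) : Prop :=
  le s t /\ s <> t.

(* r(t) is a limit ordinal: (0,t) is non-empty and has no largest element *)
Definition limit_node (T : Type) (le : T -> T -> Prop) (t : T) : Prop :=
  (exists s, tlt le s t) /\
  ~ (exists m, tlt le m t /\ forall s, tlt le s t -> le s m).

Definition is_tree (T : Type) (le : T -> T -> Prop) : Prop :=
  [/\ (forall t, le t t),
      (forall s t, le s t -> le t s -> s = t),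
      (forall r s t, le r s -> le s t -> le r t),
      (forall (t : T) (A : set T), A `<=` [set s | le s t] -> A !=set0 ->
          exists2 m, A m & forall a, A a -> le m a) &
      (* Hausdorff *)
      (forall t t', limit_node le t ->
          (forall s, tlt le s t <-> tlt le s t') -> t = t')].

Definition tinterval (T : Type) (le : T -> T -> Prop) (t : T) : set T :=
  [set s | le s t].

(** The tree topology: the coarsest topology in which every (0,t] is open and
    closed, i.e. the topology generated by the subbase of all sets (0,t] and
    their complements. *)
Definition tree_top (T : Type) (le : T -> T -> Prop) : Type := T.

HB.instance Definition _ (T : Type) (le : T -> T -> Prop) :=
  gen_eqMixin (tree_top le).
HB.instance Definition _ (T : Type) (le : T -> T -> Prop) :=
  gen_choiceMixin (tree_top le).

Definition tree_subbase (T : Type) (le : T -> T -> Prop) : set (set T) :=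
  [set A | exists t, A = tinterval le t \/ A = ~` tinterval le t].

HB.instance Definition _ (T : Type) (le : T -> T -> Prop) :=
  @isSubBaseTopological.Build (tree_top le) (set T) (tree_subbase le) id.

Definition C0 (R : realType) (T : Type) (le : T -> T -> Prop)
  : set (tree_top le -> R) :=
  [set f | continuous f /\
           forall e : R, 0 < e -> compact [set t | e <= `|f t|]].

Definition supnorm (R : realType) (X : Type) (f : X -> R) : R :=
  sup [set `|f t| | t in [set: X]].

Definition fadd (R : realType) (X : Type) (f g : X -> R) : X -> R :=
  fun t => f t + g t.
Definition fscale (R : realType) (X : Type) (a : R) (f : X -> R) : X -> R :=
  fun t => a * f t.

(** * Infinite Fréchet differentiability on a normed subspace E of X -> R.
    D n x is the n-th Fréchet derivative of phi at x, seen as an n-linear form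
    (a function of a list of n vectors). We require: D 0 = phi; each D n x is a
    bounded (continuous) n-linear form on E; and D (n+1) x is the Fréchet
    derivative of x |-> D n x in the operator norm of n-linear forms, i.e.
    D n (x+h) - D n x - D (n+1) x (h, -) = o(||h||) uniformly on the unit ball. *)

Definition in_E (R : realType) (X : Type) (E : set (X -> R)) (hs : seq (X -> R)) :=
  forall h, h \in hs -> E h.

Definition multilinear_on (R : realType) (X : Type) (E : set (X -> R))
  (n : nat) (F : seq (X -> R) -> R) : Prop :=
  forall (p s : seq (X -> R)) (u v : X -> R) (a b : R),
    (size p + size s).+1 = n -> in_E E p -> in_E E s -> E u -> E v ->
    F (p ++ fadd (fscale a u) (fscale b v) :: s)
      = a * F (p ++ u :: s) + b * F (p ++ v :: s).

Definition bounded_form_on (R : realType) (X : Type) (E : set (X -> R))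
  (n : nat) (F : seq (X -> R) -> R) : Prop :=
  exists M : R, forall hs, size hs = n -> in_E E hs ->
    `|F hs| <= M * \prod_(h <- hs) supnorm h.

Definition smooth_on (R : realType) (X : Type) (E : set (X -> R))
  (phi : (X -> R) -> R) : Prop :=
  exists D : nat -> (X -> R) -> seq (X -> R) -> R,
  [/\ (forall x, E x -> D 0%N x [::] = phi x),
      (forall n x, E x -> multilinear_on E n (D n x)),
      (forall n x, E x -> bounded_form_on E n (D n x)) &
      (forall n x, E x -> forall e : R, 0 < e -> exists2 d : R, 0 < d &
         forall h, E h -> supnorm h < d ->
         forall hs, size hs = n -> in_E E hs -> (forall k, k \in hs -> supnorm k <= 1) ->
           `|D n (fadd x h) hs - D n x hs - D n.+1 x (h :: hs)| <= e * supnorm h)].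

Definition smooth_bump (R : realType) (T : Type) (le : T -> T -> Prop)
  (phi : (tree_top le -> R) -> R) : Prop :=
  [/\ smooth_on (@C0 R T le) phi,
      (exists x, @C0 R T le x /\ phi x != 0) &
      (exists M : R, forall x, @C0 R T le x -> phi x != 0 -> supnorm x <= M)].

(* Main.v *)
(** Let [s] range over the immediate successors of [t], [w(u) = 1/(1-u^2)] and
    [b(u) = exp(-1/u)] for [u > 0], [b = 0] otherwise. The bump is
    [x |-> b (1 - K * sum_t b (w (x t) - 4 - sum_s c (x s)))] on the open unit
    ball and [0] outside, where [K = 1/b(1)] and [c(u) = K * w(u) * b(w(u) - 2)].
    Since [c >= w - 3], the term of [t] vanishes unless [w (x t) > w (x s) + 1]
    for every [s]; inside the ball this forces a drop of [x^2], bounded below,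
    from [t] to all its successors. By continuity of [x] along branches and
    compactness of its level sets, only finitely many [t] show such a drop, so
    near [x] the bump is a smooth function of finitely many coordinates. If
    [x] has norm at least 1, a maximal [t] of the compact set [|x| >= 1] has all
    [|x s| < 1] uniformly; so for [y] near [x] in the ball the term of [t] is at
    least [b(1)], and the bump vanishes near [x]. *)

Require Import Defs.
From mathcomp Require Import all_boot all_order all_algebra.
From mathcomp Require Import all_classical all_reals all_analysis.
From mathcomp Require Import ring lra.

Set Implicit Arguments.
Unset Strict Implicit.
Unset Printing Implicit Defensive.

Import Order.TTheory GRing.Theory Num.Theory.
Import numFieldNormedType.Exports.
Local Open Scope classical_set_scope.
Local Open Scope ring_scope.

(** * Calculus of formulas in finitely many coordinates *)

Section FlatFunction.
Variable R : realType.
Implicit Types u v c e d : R.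

(* The factors [u ^- n] make the family stable under differentiation:
   [(flat n)' = flat n.+2 - n * flat n.+1]. *)
Definition flat (n : nat) (u : R) : R :=
  if 0 < u then u ^- n * expR (- u^-1) else 0.

Lemma flat_ge0 n u : 0 <= flat n u.
Proof.
rewrite /flat; case: ifP => // u0.
by rewrite mulr_ge0 ?invr_ge0 ?exprn_ge0 ?expR_ge0// ltW.
Qed.

Lemma flat_le0 n u : u <= 0 -> flat n u = 0.
Proof. by rewrite /flat leNgt; case: ifP. Qed.

Lemma flat0_gt0 u : 0 < u -> 0 < flat 0 u.
Proof. by move=> u0; rewrite /flat u0 expr0 invr1 mul1r expR_gt0. Qed.

Lemma flat0_le1 u : flat 0 u <= 1.
Proof.
rewrite /flat; case: ifP => // u0.
by rewrite expr0 invr1 mul1r expR_le1 oppr_le0 invr_ge0 ltW.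
Qed.

Lemma flat0_le u v : u <= v -> flat 0 u <= flat 0 v.
Proof.
move=> uv; have [u0|u0] := ltP 0 u; last by rewrite (flat_le0 _ u0) flat_ge0.
have v0 := lt_le_trans u0 uv.
by rewrite /flat u0 v0 expr0 invr1 !mul1r ler_expR lerN2 lef_pV2.
Qed.

(** Raise [z <= expR z], at [z = u^-1 / n.+2], to the power [n.+2]: two powers of [u] beyond those
    cancelling [u ^- n] survive, so [flat n] is o(u) at 0. *)
Lemma flat_le_sqr n u : flat n u <= n.+2%:R ^+ n.+2 * u ^+ 2.
Proof.
have [u0|u0] := ltP 0 u; last first.
  by rewrite flat_le0// mulr_ge0 ?sqr_ge0// exprn_ge0.
rewrite /flat u0 expRN.
have h : (u^-1 / n.+2%:R) ^+ n.+2 <= expR u^-1.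
  rewrite -[X in expR X](divfK (_ : n.+2%:R != 0)) ?pnatr_eq0// expRM_natr.
  rewrite lerXn2r ?nnegrE ?expR_ge0 ?divr_ge0 ?invr_ge0 ?(ltW u0)//.
  by apply: le_trans (expR_ge1Dx _); rewrite lerDr.
rewrite ler_pdivrMr ?expR_gt0//.
apply: le_trans (ler_wpM2l _ h); last by rewrite mulr_ge0 ?sqr_ge0// exprn_ge0.
set M := n.+2%:R; have M0 : M != 0 :> R by rewrite pnatr_eq0.
have MV : M ^+ n.+2 * M^-1 ^+ n.+2 = 1 by rewrite -exprMn mulfV ?expr1n.
have uV : u ^+ 2 * u^-1 ^+ n.+2 = u^-1 ^+ n.
  by rewrite -[n.+2]/(2 + n)%N exprD mulrA -exprMn mulfV ?expr1n ?mul1r ?gt_eqF.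
rewrite exprMn -exprVn [leRHS](_ : _ = M ^+ n.+2 * M^-1 ^+ n.+2 * (u ^+ 2 * u^-1 ^+ n.+2)).
  by rewrite MV uV mul1r.
by rewrite [X in _ * X = _]mulrC mulrACA.
Qed.

(** Differentiability with derivative [c], written without a quotient so that [k = 0] is allowed and
    [k] can be the increment of another function. *)
Definition linear_approx (g : R -> R) u c := forall e, 0 < e ->
  exists2 d : R, 0 < d & forall k, `|k| <= d -> `|g (u + k) - g u - c * k| <= e * `|k|.

Lemma is_derive_linear_approx (g : R -> R) u c :
  is_derive u (1 : R) g c -> linear_approx g u c.
Proof.
move=> gc e e0.
have gD : derivable g u 1 by [].
have gE : 'D_1 g u = c by exact: derive_val.
have /cvgrPdist_le/(_ _ e0) : h^-1 *: (g (h *: 1 + u) - g u) @[h --> 0^'] --> c.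
  by rewrite -gE; exact: gD.
rewrite near_withinE => /nbhs_ballP[d /= d0 dP].
exists (d / 2); first by rewrite divr_gt0.
move=> k kd; have [->|k0] := eqVneq k 0.
  by rewrite addr0 mulr0 subrr subr0 normr0 mulr0.
have := dP k; rewrite /ball/= sub0r normrN => /(_ _ k0) h.
have {}h := h (le_lt_trans kd _).
have -> : g (u + k) - g u - c * k = - ((c - k^-1 * (g (k * 1 + u) - g u)) * k).
  by rewrite mulr1 [k + u]addrC; field.
rewrite normrN normrM ler_wpM2r//; apply: h.
by rewrite ltr_pdivrMr// ltr_pMr// ltr1n.
Qed.

(** Left of 0 the function is locally 0 and right of 0 the usual rules apply; at 0 the claimed
    derivative is 0, and [flat_le_sqr] bounds the increment quadratically. *)
Lemma flat_linear_approx n u :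
  linear_approx (flat n) u (flat n.+2 u - n%:R * flat n.+1 u).
Proof.
have [u0|u0|->] := ltgtP u 0.
- rewrite !flat_le0 ?ltW// mulr0 subr0 => e e0.
  exists (- u); first by rewrite oppr_gt0.
  move=> k ku; rewrite !flat_le0 ?(ltW u0) ?mul0r ?subr0 ?normr0 ?mulr_ge0 ?(ltW e0)//.
  by have := le_trans (ler_norm k) ku; lra.
- move=> e e0.
  have u0' : u != 0 by rewrite gt_eqF.
  have : is_derive u (1 : R) (fun x => x ^- n * expR (- x^-1))
      (u ^- n.+2 * expR (- u^-1) - n%:R * (u ^- n.+1 * expR (- u^-1))).
    have d1 : is_derive u (1 : R) (fun x : R => x^-1) (- u ^- 2).
      have := @is_deriveV R id u 1 1 u0' (is_derive_id _ _).
      by move=> h; apply: is_derive_eq h _; rewrite /= /GRing.scale/= mulr1.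
    have d2 : is_derive u (1 : R) (fun x : R => expR (- x^-1))
        (u ^- 2 * expR (- u^-1)).
      have d3 : is_derive u (1 : R) (fun x : R => - x^-1) (u ^- 2).
        by apply: is_derive_eq (is_deriveN d1) _; rewrite opprK.
      apply: is_derive_eq (is_derive1_comp (is_derive_expR _) d3) _.
      by rewrite mulrC.
    have d4 : is_derive u (1 : R) (fun x : R => x ^- n) (- n%:R * u ^- n.+1).
      have := is_deriveX n d1.
      rewrite [X in is_derive _ _ X _](_ : _ = (fun x : R => x ^- n)); last first.
        by apply/funext => x /=; rewrite exprfctE exprVn.
      move=> h; apply: is_derive_eq h _; rewrite /GRing.scale/=.
      case: n => [|n]; first by rewrite !mul0r oppr0 mul0r.
      by rewrite /= -!exprVn !exprS expr0; ring.
    apply: is_derive_eq (is_deriveM d4 d2) _.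
    rewrite /GRing.scale/= -!exprVn !exprS expr0; ring.
  move=> /is_derive_linear_approx/(_ _ e0)[d d0 dP].
  (* The bound [u / 2] keeps [u + k] positive, where [flat n] is the expression just
     differentiated. *)
  exists (Num.min d (u / 2)); first by rewrite lt_min d0 divr_gt0.
  move=> k; rewrite le_min => /andP[kd ku].
  have uk : 0 < u + k.
    by have := le_trans (ler_norm (- k)) _; move/(_ (u / 2)); rewrite normrN; lra.
  by rewrite /flat u0 uk; exact: dP.
- rewrite !(@flat_le0 _ 0)// mulr0 subr0 => e e0.
  pose M := (n.+2%:R : R) ^+ n.+2.
  have M0 : 0 < M by rewrite exprn_gt0.
  exists (e / M); first by rewrite divr_gt0.
  move=> k kM; rewrite (@flat_le0 n 0)// mul0r !subr0 add0r ger0_norm ?flat_ge0//.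
  apply: le_trans (flat_le_sqr _ _) _; rewrite -/M -real_normK ?num_real//.
  by rewrite expr2 mulrA ler_wpM2r// mulrC -ler_pdivlMr.
Qed.

Lemma inv_linear_approx u : u != 0 -> linear_approx GRing.inv u (- (u^-1) ^+ 2).
Proof.
move=> u0; apply: is_derive_linear_approx.
have := @is_deriveV R id u 1 1 u0 (is_derive_id _ _).
by move=> h; apply: is_derive_eq h _; rewrite /= /GRing.scale/= mulr1 exprVn.
Qed.

End FlatFunction.

(** * Differentials in finitely many coordinates *)

Section FormulaCalculus.
Variables (R : realType) (X : eqType).
Implicit Types (x y h k : X -> R) (F : seq X) (c : X -> R).

Definition lin F c h : R := \sum_(t <- F) c t * h t.

(** The size of [h] is measured by any [r] bounding all its coordinates, because [supnorm] controls
    the coordinates of bounded functions only. *)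
Definition is_differential (f : (X -> R) -> R) x F c := forall e, 0 < e ->
  exists2 d : R, 0 < d & forall r h, 0 <= r <= d -> (forall t, `|h t| <= r) ->
    `|f (fadd x h) - f x - lin F c h| <= e * r.

Lemma lin_bound F c : exists2 M, 0 <= M & forall r h,
  (forall t, `|h t| <= r) -> `|lin F c h| <= M * r.
Proof.
exists (\sum_(t <- F) `|c t|) => [|r h hr]; first exact: sumr_ge0.
apply: le_trans (ler_norm_sum _ _ _) _; rewrite mulr_suml ler_sum// => t _.
by rewrite normrM ler_wpM2l.
Qed.

Lemma is_differential_lipschitz (f : (X -> R) -> R) x F c :
  is_differential f x F c ->
  exists2 C, 0 < C & exists2 d : R, 0 < d &
    forall r h, 0 <= r <= d -> (forall t, `|h t| <= r) ->
      `|f (fadd x h) - f x| <= C * r.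
Proof.
move=> /(_ 1 ltr01)[d d0 dP]; have [M M0 MP] := lin_bound F c.
exists (1 + M); first by rewrite ltr_pwDl.
exists d => // r h rd hr.
rewrite -(subrK (lin F c h) (_ - _)) mulrDl.
by rewrite (le_trans (ler_normD _ _))// lerD ?dP ?MP.
Qed.

Lemma is_differential_cst (a : R) x F : is_differential (fun=> a) x F (fun=> 0).
Proof.
move=> e e0; exists 1 => // r h /andP[r0 _] hr.
by rewrite /lin big1 ?subrr ?subr0 ?normr0 ?mulr_ge0 ?(ltW e0)// => t _; rewrite mul0r.
Qed.

Lemma is_differential_coord s x F : uniq F -> s \in F ->
  is_differential (fun y => y s) x F (fun t => (s == t)%:R).
Proof.
move=> uF sF e e0; exists 1 => // r h /andP[r0 _] hr.
rewrite /lin (bigD1_seq s)//= eqxx mul1r big1 => [|t].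
  rewrite [X in `|X|](_ : _ = 0); last by rewrite /fadd; ring.
  by rewrite normr0 mulr_ge0 ?(ltW e0).
by rewrite eq_sym => /negbTE ->; rewrite mul0r.
Qed.

Lemma is_differentialD f g x F c c' :
  is_differential f x F c -> is_differential g x F c' ->
  is_differential (fun y => f y + g y) x F (fun t => c t + c' t).
Proof.
move=> fD gD e e0; have e20 : 0 < e / 2 by rewrite divr_gt0.
have [d d0 dP] := fD _ e20; have [d' d'0 d'P] := gD _ e20.
exists (Num.min d d'); first by rewrite lt_min d0.
move=> r h /andP[r0]; rewrite le_min => /andP[rd rd'] hr.
have -> : lin F (fun t => c t + c' t) h = lin F c h + lin F c' h.
  by rewrite /lin -big_split; apply: eq_bigr => t _; rewrite mulrDl.
have := dP r h; have := d'P r h; rewrite r0 rd rd' => /(_ erefl hr) H /(_ erefl hr) H'.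
rewrite [e]splitr mulrDl; apply: le_trans (lerD H' H).
by rewrite (le_trans _ (ler_normD _ _))// le_eqVlt; apply/orP; left; apply/eqP; congr `|_|; ring.
Qed.

Lemma is_differentialM f g x F c c' :
  is_differential f x F c -> is_differential g x F c' ->
  is_differential (fun y => f y * g y) x F (fun t => f x * c' t + g x * c t).
Proof.
move=> fD gD e e0.
have [C C0 [d1 d10 fL]] := is_differential_lipschitz fD.
have [C' C'0 [d2 d20 gL]] := is_differential_lipschitz gD.
(* One third of the error goes to the remainder of [g] times [f x], one to the remainder of [f]
   times [g x], one to the product of the increments. The [+ 1] covers vanishing values. *)
pose e1 := e / 3 / (`|f x| + 1); pose e2 := e / 3 / (`|g x| + 1).
have e10 : 0 < e1 by rewrite !divr_gt0// ltr_wpDl.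
have e20 : 0 < e2 by rewrite !divr_gt0// ltr_wpDl.
have [d3 d30 fP] := fD _ e20; have [d4 d40 gP] := gD _ e10.
pose d5 := e / 3 / (C * C').
have d50 : 0 < d5 by rewrite !divr_gt0// mulr_gt0.
exists (Num.min (Num.min d1 d2) (Num.min (Num.min d3 d4) d5)).
  by rewrite !lt_min d10 d20 d30 d40.
move=> r h /andP[r0]; rewrite !le_min => /andP[/andP[r1 r2] /andP[/andP[r3 r4] r5]] hr.
have -> : lin F (fun t => f x * c' t + g x * c t) h = f x * lin F c' h + g x * lin F c h.
  by rewrite /lin !mulr_sumr -big_split; apply: eq_bigr => t _ /=; ring.
have {}fL := fL r h; have {}gL := gL r h; have {}fP := fP r h; have {}gP := gP r h.
rewrite r0 r1 in fL; rewrite r0 r2 in gL; rewrite r0 r3 in fP; rewrite r0 r4 in gP.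
move: (fL erefl hr) (gL erefl hr) (fP erefl hr) (gP erefl hr).
set f' := f (fadd _ _); set g' := g (fadd _ _); set l := lin F c h; set l' := lin F c' h.
move=> {}fL {}gL {}fP {}gP.
have -> : f' * g' - f x * g x - (f x * l' + g x * l) =
  f x * (g' - g x - l') + g x * (f' - f x - l) + (f' - f x) * (g' - g x) by ring.
have -> : e * r = e / 3 * r + e / 3 * r + e / 3 * r by field.
have small (a b : R) (u : R) : `|b| <= e / 3 / (`|a| + 1) * u -> 0 <= u -> `|a * b| <= e / 3 * u.
  move=> ub u0; rewrite normrM (le_trans (ler_wpM2l _ ub))//.
  rewrite mulrA ler_wpM2r// mulrCA ler_piMr ?divr_ge0 ?(ltW e0)//.
  by rewrite ler_pdivrMr ?mul1r ?lerDl// ltr_wpDl.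
rewrite (le_trans (ler_normD _ _))// lerD//.
  by rewrite (le_trans (ler_normD _ _))// lerD// small.
rewrite normrM (le_trans (ler_pM _ _ fL gL))//.
rewrite mulrACA mulrA ler_wpM2r//.
by rewrite mulrC -ler_pdivlMr ?mulr_gt0.
Qed.

Lemma is_differential_comp (g : R -> R) (a : R) f x F c :
  is_differential f x F c -> linear_approx g (f x) a ->
  is_differential (fun y => g (f y)) x F (fun t => a * c t).
Proof.
move=> fD gD e e0.
have [C C0 [d1 d10 fL]] := is_differential_lipschitz fD.
pose e1 := e / 2 / (`|a| + 1); have e10 : 0 < e1 by rewrite !divr_gt0// ltr_wpDl.
have [d2 d20 fP] := fD _ e10.
have [|d3 d30 gP] := gD (e / 2 / C); first by rewrite !divr_gt0.
exists (Num.min (Num.min d1 d2) (d3 / C)); first by rewrite !lt_min d10 d20 divr_gt0.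
move=> r h /andP[r0]; rewrite !le_min => /andP[/andP[r1 r2] r3] hr.
have -> : lin F (fun t => a * c t) h = a * lin F c h.
  by rewrite /lin !mulr_sumr; apply: eq_bigr => t _ /=; rewrite mulrA.
have {}fL := fL r h; have {}fP := fP r h.
rewrite r0 r1 in fL; rewrite r0 r2 in fP.
move: (fL erefl hr) (fP erefl hr); set k := _ - f x => {}fL {}fP.
have kd : `|k| <= d3 by rewrite (le_trans fL)// mulrC -ler_pdivlMr.
have {gP} := gP _ kd.
have -> : f x + k = f (fadd x h) by rewrite /k addrC subrK.
set g' := g (f (fadd x h)) => gP.
have -> : g' - g (f x) - a * lin F c h = (g' - g (f x) - a * k) + a * (k - lin F c h) by ring.
rewrite (le_trans (ler_normD _ _))// [e]splitr mulrDl lerD//.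
  rewrite (le_trans gP)// (le_trans (ler_wpM2l _ fL)) ?divr_ge0 ?(ltW e0) ?(ltW C0)//.
  by rewrite mulrA divfK ?gt_eqF.
rewrite normrM (le_trans (ler_wpM2l _ fP))//.
rewrite mulrA ler_wpM2r// mulrCA ler_piMr ?divr_ge0 ?(ltW e0)//.
by rewrite ler_pdivrMr ?mul1r ?lerDl// ltr_wpDl.
Qed.

(* Formulas reify the functions of finitely many coordinates used below; being
   closed under [pd], they carry all their iterated partial derivatives. *)
Inductive expr :=
  | Coord of X | Cst of R | Add of expr & expr | Mul of expr & expr
  | Inv of expr | Flat of nat & expr.

Fixpoint ev y e : R := match e with
  | Coord t => y t | Cst a => a
  | Add e1 e2 => ev y e1 + ev y e2 | Mul e1 e2 => ev y e1 * ev y e2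
  | Inv e1 => (ev y e1)^-1 | Flat n e1 => flat n (ev y e1) end.

Fixpoint pd t e : expr := match e with
  | Coord s => Cst (s == t)%:R
  | Cst _ => Cst 0
  | Add e1 e2 => Add (pd t e1) (pd t e2)
  | Mul e1 e2 => Add (Mul e1 (pd t e2)) (Mul e2 (pd t e1))
  | Inv e1 => Mul (Mul (Cst (- 1)) (Mul (Inv e1) (Inv e1))) (pd t e1)
  | Flat n e1 =>
      Mul (Add (Flat n.+2 e1) (Mul (Cst (- n%:R)) (Flat n.+1 e1))) (pd t e1) end.

Fixpoint coords e : seq X := match e with
  | Coord t => [:: t] | Cst _ => [::]
  | Add e1 e2 | Mul e1 e2 => coords e1 ++ coords e2
  | Inv e1 | Flat _ e1 => coords e1 end.

(** Only inversion needs a side condition: [flat n] is differentiable on the whole line. *)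
Fixpoint defined_at y e : bool := match e with
  | Coord _ | Cst _ => true
  | Add e1 e2 | Mul e1 e2 => defined_at y e1 && defined_at y e2
  | Inv e1 => (ev y e1 != 0) && defined_at y e1
  | Flat _ e1 => defined_at y e1 end.

Lemma coords_pd t e : {subset coords (pd t e) <= coords e}.
Proof.
elim: e => [s|a|e1 IH1 e2 IH2|e1 IH1 e2 IH2|e1 IH1|n e1 IH1] s' //=;
  rewrite ?cats0 !mem_cat.
- by move=> /orP[/IH1|/IH2] ->; rewrite ?orbT.
- by move=> /orP[/orP[->|/IH2 ->]|/orP[->|/IH1 ->]]; rewrite ?orbT.
- by move=> /orP[|/IH1 //]; rewrite orbb.
- by move=> /orP[|/IH1 //]; rewrite orbb.
Qed.

Lemma defined_at_pd y t e : defined_at y e -> defined_at y (pd t e).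
Proof.
elim: e => [s|a|e1 IH1 e2 IH2|e1 IH1 e2 IH2|e1 IH1|n e1 IH1] //=.
- by move=> /andP[/IH1 -> /IH2 ->].
- by move=> /andP[d1 d2]; rewrite d1 d2 IH1 ?IH2.
- by move=> /andP[-> d1]; rewrite d1 IH1.
- by move=> d1; rewrite d1 IH1.
Qed.

Lemma ev_differential y e F : uniq F -> {subset coords e <= F} -> defined_at y e ->
  is_differential (fun z => ev z e) y F (fun t => ev y (pd t e)).
Proof.
move=> uF; elim: e => [s|a|e1 IH1 e2 IH2|e1 IH1 e2 IH2|e1 IH1|n e1 IH1] /= sF.
- by move=> _; apply: is_differential_coord => //; apply: sF; rewrite mem_head.
- by move=> _; exact: is_differential_cst.
- move=> /andP[d1 d2]; apply: is_differentialD; [apply: IH1|apply: IH2] => // s sc;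
    by apply: sF; rewrite mem_cat sc ?orbT.
- move=> /andP[d1 d2]; apply: is_differentialM; [apply: IH1|apply: IH2] => // s sc;
    by apply: sF; rewrite mem_cat sc ?orbT.
- move=> /andP[n0 d1].
  rewrite (_ : (fun _ => _) = fun t => - (ev y e1)^-1 ^+ 2 * ev y (pd t e1)).
    by apply: is_differential_comp (IH1 sF d1) _; exact: inv_linear_approx.
  by apply/funext => t; rewrite expr2 mulN1r.
- move=> d1.
  rewrite (_ : (fun _ => _) = fun t =>
      (flat n.+2 (ev y e1) - n%:R * flat n.+1 (ev y e1)) * ev y (pd t e1)).
    by apply: is_differential_comp (IH1 sF d1) _; exact: flat_linear_approx.
  by apply/funext => t; rewrite mulNr.
Qed.

End FormulaCalculus.

(** * Higher derivatives, and smoothness from local formulas *)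

Section IteratedDerivatives.
Variables (R : realType) (X : eqType).
Implicit Types (x y h k : X -> R) (F : seq X) (J : seq X -> R) (hs : seq (X -> R)).

(* The form of order [size hs] whose coefficient on the coordinates [ts] is [J ts]. *)
Fixpoint form F J hs : R := match hs with
  | [::] => J [::]
  | h :: hs' => \sum_(t <- F) h t * form F (fun ts => J (t :: ts)) hs' end.

Lemma form_sum F (I : Type) (r : seq I) (c : I -> R) (J : I -> seq X -> R) hs :
  form F (fun ts => \sum_(i <- r) c i * J i ts) hs = \sum_(i <- r) c i * form F (J i) hs.
Proof.
elim: hs J => [//|h hs IH] J /=.
under [RHS]eq_bigr do rewrite mulr_sumr.
rewrite exchange_big/=; apply: eq_bigr => t _.
by rewrite IH mulr_sumr; apply: eq_bigr => i _; rewrite mulrCA.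
Qed.

Lemma formB F J J' hs : form F (fun ts => J ts - J' ts) hs = form F J hs - form F J' hs.
Proof.
elim: hs J J' => [//|h hs IH] J J' /=.
by rewrite -sumrB; apply: eq_bigr => t _; rewrite IH mulrBr.
Qed.

Lemma form_multilinear F J (p s : seq (X -> R)) u v (a b : R) :
  form F J (p ++ fadd (fscale a u) (fscale b v) :: s) =
  a * form F J (p ++ u :: s) + b * form F J (p ++ v :: s).
Proof.
elim: p J => [|h p IH] J /=.
  by rewrite !mulr_sumr -big_split; apply: eq_bigr => t _ /=; rewrite /fadd /fscale; ring.
rewrite !mulr_sumr -big_split; apply: eq_bigr => t _ /=.
by rewrite IH; ring.
Qed.

(** [N] stands in for [supnorm], and [M] is the sum of the absolute values of the finitely many
    coefficients. *)
Lemma form_bounded F n J : exists2 M, 0 <= M & forall (N : (X -> R) -> R) hs,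
  size hs = n -> (forall k, k \in hs -> forall t, `|k t| <= N k) ->
  `|form F J hs| <= M * \prod_(k <- hs) N k.
Proof.
elim: n J => [|n IH] J.
  by exists `|J [::]| => // N [|//] _ _; rewrite big_nil mulr1.
have /choice[M MP] : forall t, exists M, 0 <= M /\ forall (N : (X -> R) -> R) hs,
    size hs = n -> (forall k, k \in hs -> forall t, `|k t| <= N k) ->
    `|form F (fun ts => J (t :: ts)) hs| <= M * \prod_(k <- hs) N k.
  by move=> t; have [M M0 MP] := IH (fun ts => J (t :: ts)); exists M.
exists (\sum_(t <- F) M t) => [|N [//|h hs] [sn] hN].
  by apply: sumr_ge0 => t _; have [] := MP t.
rewrite /= big_cons mulr_suml (le_trans (ler_norm_sum _ _ _))// ler_sum// => t _.
rewrite normrM mulrCA ler_pM//; first by rewrite hN// mem_head.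
by have [_] := MP t; apply=> // k kh; apply: hN; rewrite inE kh orbT.
Qed.

Lemma finite_radius F (P : X -> R -> Prop) :
  (forall t (d d' : R), d' <= d -> P t d -> P t d') ->
  (forall t, exists2 d : R, 0 < d & P t d) ->
  exists2 d : R, 0 < d & forall t, t \in F -> P t d.
Proof.
move=> Pmono Pex; elim: F => [|s F [d d0 dP]]; first by exists 1.
have [d' d'0 d'P] := Pex s; exists (Num.min d d'); first by rewrite lt_min d0.
move=> t; rewrite inE => /predU1P[->|tF].
  by apply: Pmono d'P; rewrite ge_min lexx orbT.
by apply: Pmono (dP _ tF); rewrite ge_min lexx.
Qed.

(** The form is a finite sum of coefficients times products of coordinates bounded by [B], so a
    little-o for each coefficient becomes uniform over all [hs]. *)
Lemma form_uniform_littleo F n (B : R) (er : (X -> R) -> seq X -> R) : 0 <= B ->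
  (forall ts e, 0 < e -> exists2 d : R, 0 < d & forall r h, 0 <= r <= d ->
     (forall t, `|h t| <= r) -> `|er h ts| <= e * r) ->
  forall e, 0 < e -> exists2 d : R, 0 < d & forall r h, 0 <= r <= d ->
     (forall t, `|h t| <= r) -> forall hs, size hs = n ->
     (forall k, k \in hs -> forall t, `|k t| <= B) -> `|form F (er h) hs| <= e * r.
Proof.
move=> B0; elim: n er => [|n IH] er erP e e0.
  have [d d0 dP] := erP [::] _ e0; exists d => // r h rd hr [|//] _ _; exact: dP.
(* Each of the [size F] terms contributes at most [B * (e / S * r)]; the [+ 1] makes [S]
   positive. *)
pose S := (size F)%:R * B + 1; have S0 : 0 < S by rewrite ltr_wpDl// mulr_ge0.
pose P t d := forall r h, 0 <= r <= d -> (forall t, `|h t| <= r) ->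
  forall hs, size hs = n -> (forall k, k \in hs -> forall t, `|k t| <= B) ->
  `|form F (fun ts => er h (t :: ts)) hs| <= e / S * r.
have [t d d' d'd Pd|t|d d0 dP] := @finite_radius F P.
- by move=> r h /andP[r0 rd]; apply: Pd; rewrite r0 (le_trans rd).
- have [||d d0 dP] := IH (fun h ts => er h (t :: ts)) _ (e / S).
  + by move=> ts; exact: erP.
  + by rewrite divr_gt0.
  + by exists d.
exists d => // r h /andP[r0 rd] hr [//|k hs] [sn] hB.
rewrite /= (le_trans (ler_norm_sum _ _ _))//.
apply: (@le_trans _ _ (\sum_(t <- F) B * (e / S * r))).
  rewrite big_seq [leRHS]big_seq ler_sum// => t tF.
  rewrite normrM ler_pM//; first by rewrite hB// mem_head.
  by apply: dP => //; [rewrite r0|move=> k' k'h; apply: hB; rewrite inE k'h orbT].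
rewrite big_const_seq count_predT iter_addr_0 -mulr_natl.
have -> : (size F)%:R * (B * (e / S * r)) = (size F)%:R * B / S * (e * r) by ring.
rewrite ler_piMl ?mulr_ge0 ?(ltW e0)//.
by rewrite ler_pdivrMr ?mul1r ?lerDl.
Qed.

Lemma derive1_linear_approx (g : R -> R) (a c : R) : linear_approx g a c -> derive1 g a = c.
Proof.
move=> gc; apply/cvg_lim => //; apply/cvgrPdist_le => e e0.
have [d d0 dP] := gc _ e0.
near=> k; have k0 : k != 0 by near: k; exact: nbhs_dnbhs_neq.
have kd : `|k| <= d.
  near: k; apply: nbhs_dnbhs; apply/nbhs_ballP; exists d => //= k.
  by rewrite /ball/= sub0r normrN => /ltW.
have := dP _ kd.
have -> : g (a + k) - g a - c * k = - ((c - k^-1 *: (g (k + a) - g a)) * k).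
  by rewrite /GRing.scale/= [k + a]addrC; field.
by rewrite normrN normrM ler_pM2r// normr_gt0.
Unshelve. all: by end_near. Qed.

(** The head of [ts] is the derivative taken last, so consing [t] differentiates once more. *)
Definition jet e y : seq X -> R := fun ts => ev y (foldr (@pd R X) e ts).

Lemma jet_differential e y F : uniq F -> {subset coords e <= F} -> defined_at y e ->
  forall ts, is_differential (fun z => jet e z ts) y F (fun t => jet e y (t :: ts)).
Proof.
move=> uF sF dy ts; apply: ev_differential => //.
  by elim: ts => [//|t ts IH] s /coords_pd /IH.
by elim: ts => [//|t ts IH] /=; exact: defined_at_pd.
Qed.

(** Each coefficient has a differential by [jet_differential]; linearity of [form] in its
    coefficients gathers the linear parts into the form of next order, with [h] as first vector. *)
Lemma form_differential e y F n (B : R) : uniq F -> {subset coords e <= F} ->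
  defined_at y e -> 0 <= B ->
  forall eps, 0 < eps -> exists2 d : R, 0 < d & forall r h, 0 <= r <= d ->
    (forall t, `|h t| <= r) -> forall hs, size hs = n ->
    (forall k, k \in hs -> forall t, `|k t| <= B) ->
    `|form F (jet e (fadd y h)) hs - form F (jet e y) hs - form F (jet e y) (h :: hs)|
      <= eps * r.
Proof.
move=> uF sF dy B0 eps eps0.
pose er h ts := jet e (fadd y h) ts - jet e y ts - lin F (fun t => jet e y (t :: ts)) h.
have [ts|d d0 dP] := @form_uniform_littleo F n B er B0 _ _ eps0.
  exact: jet_differential.
exists d => // r h rd hr hs sn hB.
have := dP r h rd hr hs sn hB; rewrite /er 2!formB /lin.
congr (`|_ - _| <= _); rewrite /= -form_sum; congr (form F _ hs).
by apply/funext => ts; apply: eq_bigr => t _; rewrite mulrC.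
Qed.

(** [smooth_on] asks for one family of derivatives at all points, while formulas are only local.
    Iterated directional derivatives are intrinsic to [phi], so no formulas have to be chosen
    compatibly. *)
Fixpoint gateaux (phi : (X -> R) -> R) hs x : R := match hs with
  | [::] => phi x
  | h :: hs' => derive1 (fun s : R => gateaux phi hs' (fadd x (fscale s h))) 0 end.

Variable E : set (X -> R).
Hypothesis EB : forall h, E h -> forall t, `|h t| <= supnorm h.
Hypothesis E_add : forall h k, E h -> E k -> E (fadd h k).
Hypothesis E_scale : forall (a : R) h, E h -> E (fscale a h).

(** The strict [r < d] leaves room to displace [y] slightly, as directional derivatives require. *)
Definition formula_near (phi : (X -> R) -> R) x (d : R) e := forall y r, E y -> r < d ->
  (forall t, `|y t - x t| <= r) -> defined_at y e /\ phi y = ev y e.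

(** Induction on [hs]: at [fadd y (fscale s h)] with [s] small the formula is still valid, so the
    outer derivative is that of a form, given by [form_differential]. *)
Lemma gateaux_formula phi x d e : formula_near phi x d e ->
  forall hs, in_E E hs -> forall r y, E y -> r < d ->
  (forall t, `|y t - x t| <= r) ->
  gateaux phi hs y = form (undup (coords e)) (jet e y) hs.
Proof.
move=> phiE; elim=> [|h hs IH] hE r y Ey rd yr.
  by have [] := phiE _ _ Ey rd yr.
have Eh : E h by apply: hE; rewrite mem_head.
have hsE : in_E E hs by move=> k kh; apply: hE; rewrite inE kh orbT.
have [dy _] := phiE _ _ Ey rd yr.
pose N := \sum_(k <- hs) `|supnorm k|.
have NP k : k \in hs -> forall t, `|k t| <= N.
  move=> kh t; rewrite (le_trans (EB (hsE _ kh) t))// /N.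
  by rewrite (big_rem _ kh)/= (le_trans (ler_norm _))// lerDl sumr_ge0.
have N0 : 0 <= N by rewrite sumr_ge0.
pose m := 1 + `|supnorm h|; have m0 : 0 < m by rewrite ltr_pwDl.
have hm t : `|h t| <= m.
  by rewrite (le_trans (EB Eh t))// (le_trans (ler_norm _))// lerDr.
rewrite -[LHS]/(derive1 (fun s : R => gateaux phi hs (fadd y (fscale s h))) 0).
apply: derive1_linear_approx => eps eps0.
have [||eta eta0 etaP] := @form_differential e y (undup (coords e)) (size hs) N
  (undup_uniq _) _ dy N0 (eps / m).
- by move=> t; rewrite mem_undup.
- by rewrite divr_gt0.
(* The first bound puts |s| m within [eta]; the second keeps r + |s| m below [d], so the induction
   hypothesis applies at the displaced point. *)
exists (Num.min (eta / m) ((d - r) / 2 / m)).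
  by rewrite lt_min !divr_gt0// subr_gt0.
move=> s; rewrite le_min => /andP[seta sd]; rewrite add0r.
have shs t : `|fscale s h t| <= `|s| * m by rewrite /fscale normrM ler_wpM2l.
have y0 : fadd y (fscale 0 h) = y by apply/funext => t; rewrite /fadd /fscale mul0r addr0.
rewrite (IH hsE (r + `|s| * m)); last 3 first.
- by apply: E_add => //; exact: E_scale.
- by move: sd; rewrite ler_pdivlMr//; lra.
- move=> t; have := yr t; have := shs t; rewrite /fadd => h1 h2.
  have -> : y t + fscale s h t - x t = (y t - x t) + fscale s h t by ring.
  by rewrite (le_trans (ler_normD _ _))// lerD.
rewrite (IH hsE r); last 3 first; rewrite ?y0//.
have := etaP (`|s| * m) (fscale s h) _ shs hs erefl NP.
rewrite mulr_ge0 ?(ltW m0)//= -ler_pdivlMr// => /(_ seta).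
have -> : eps / m * (`|s| * m) = eps * `|s| by field; rewrite gt_eqF.
congr (`|_ - _| <= _); rewrite mulr_suml; apply: eq_bigr => t _.
by rewrite /fscale; ring.
Qed.

Lemma smooth_on_local_formula phi :
  (forall x, E x -> exists d e, 0 < d /\ formula_near phi x d e) -> smooth_on E phi.
Proof.
move=> loc; exists (fun _ x hs => gateaux phi hs x).
have self x : forall t : X, `|x t - x t : R| <= 0 by move=> t; rewrite subrr normr0.
split=> //.
- move=> n x Ex p s u v a b _ Ep Es Eu Ev.
  have [d [e [d0 phiE]]] := loc x Ex.
  have Ecat w : E w -> in_E E (p ++ w :: s).
    by move=> Ew k; rewrite mem_cat inE => /or3P[/Ep|/eqP->|/Es].
  rewrite !(gateaux_formula phiE _ Ex d0 (self x)) ?form_multilinear//;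
    by apply: Ecat => //; apply: E_add; exact: E_scale.
- move=> n x Ex; have [d [e [d0 phiE]]] := loc x Ex.
  have [M M0 MP] := form_bounded (undup (coords e)) n (jet e x).
  exists M => hs sn hE; rewrite (gateaux_formula phiE hE Ex d0 (self x)).
  by apply: MP => // k kh; exact/EB/hE.
- move=> n x Ex eps eps0; have [d [e [d0 phiE]]] := loc x Ex.
  have [dx _] := phiE _ _ Ex d0 (self x).
  have [|eta eta0 etaP] := @form_differential e x (undup (coords e)) n 1
    (undup_uniq _) _ dx ler01 _ eps0.
    by move=> t; rewrite mem_undup.
  (* Within [d] one formula computes the derivatives both at [x] and at [fadd x h]. *)
  exists (Num.min d eta); first by rewrite lt_min d0.
  move=> h Eh; rewrite lt_min => /andP[hd heta] hs sn hsE hs1.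
  have hh t : `|fadd x h t - x t| <= supnorm h.
    by rewrite /fadd addrAC subrr add0r EB.
  rewrite (gateaux_formula phiE hsE (E_add Ex Eh) hd hh).
  rewrite !(gateaux_formula phiE _ Ex d0 (self x))//; last first.
    by move=> k; rewrite inE => /predU1P[->//|/hsE].
  apply: etaP => //; last 2 first.
  + exact: EB.
  + by move=> k kh t; rewrite (le_trans (EB (hsE _ kh) t))// hs1.
  rewrite (ltW heta) andbT.
  (* [supnorm h] is nonnegative because it bounds some coordinate; on an empty [X] it is the
     supremum of the empty set, which is 0. *)
  have [[t _]|X0] := pselect (exists t : X, True).
    by rewrite (le_trans _ (EB Eh t)).
  rewrite /supnorm (_ : [set _ | _ in _] = set0) ?sup0//.
  by rewrite -subset0 => u [t _ _]; case: X0; exists t.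
Qed.

End IteratedDerivatives.

(** * Trees *)

(** If [Q K] failed, the sets whose complement in [K] satisfies [Q] would form a proper filter
    containing [K]. A neighbourhood in [Q] of a cluster point has its complement in this filter, a
    contradiction. *)
Lemma compact_ideal (Y : topologicalType) (K : set Y) (Q : set Y -> Prop) :
  Q set0 -> (forall A B, A `<=` B -> Q B -> Q A) ->
  (forall A B, Q A -> Q B -> Q (A `|` B)) -> compact K ->
  (forall x, K x -> exists2 N, nbhs x N & Q N) -> Q K.
Proof.
move=> Q0 Qsub QU cK loc; apply: contrapT => nQK.
pose F : set_system Y := [set A | Q (K `\` A)].
have FF : ProperFilter F.
  split; first by rewrite /F/= setD0.
  split; rewrite /F/=.
  - by rewrite setDT.
  - move=> A B QA QB; apply: Qsub (QU _ _ QA QB).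
    by rewrite setDIr.
  - by move=> A B AB; apply: Qsub; exact: setDS.
have FK : F K by rewrite /F/= setDv.
have [x [Kx clx]] := cK F FF FK.
have [N Nx QN] := loc x Kx.
have FN : F (~` N) by rewrite /F/= setDE setCK; apply: Qsub QN; exact: subIsetr.
by have [z [] ] := clx _ _ FN Nx.
Qed.

Lemma finite_subsingleton (Y : choiceType) (A : set Y) :
  (forall a b, A a -> A b -> a = b) -> finite_set A.
Proof.
move=> A1; have [[a Aa]|A0] := pselect (A !=set0).
  by apply: (sub_finite_set _ (finite_set1 a)) => b Ab; exact: A1.
by rewrite (_ : A = set0)//; apply/seteqP; split=> // a Aa; apply: A0; exists a.
Qed.

Lemma compact_finite_set (Y : topologicalType) (K S : set Y) : compact K ->
  (forall x, K x -> exists2 N, nbhs x N & finite_set (N `&` S)) -> finite_set (K `&` S).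
Proof.
move=> cK; apply: (@compact_ideal _ _ (fun A => finite_set (A `&` S))) => //.
- by rewrite set0I.
- by move=> A B AB; apply: sub_finite_set => a [/AB].
- by move=> A B fA fB; rewrite setIUl finite_setU.
Qed.

(** * Order and topology of the tree *)

Section Trees.
Variables (R : realType) (T : Type) (le : T -> T -> Prop).
Hypothesis tree_le : is_tree le.
Notation X := (tree_top le).
Implicit Types (s t u v : X) (x y h : X -> R).

Let tle_refl t : le t t. Proof. by case: tree_le. Qed.
Let tle_anti s t : le s t -> le t s -> s = t. Proof. by case: tree_le => _ + _ _ _; apply. Qed.
Let tle_trans s t u : le s t -> le t u -> le s u.
Proof. by case: tree_le => _ _ + _ _; apply. Qed.
Let tle_well u (A : set X) : A `<=` [set s | le s u] -> A !=set0 ->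
  exists2 m, A m & forall a, A a -> le m a.
Proof. by case: tree_le => _ _ _ + _; apply. Qed.

Definition isucc t s := tlt le t s /\ forall u, tlt le t u -> le u s -> u = s.

Lemma isucc_exists t u : tlt le t u -> exists2 s, isucc t s & le s u.
Proof.
move=> tu; have [||m [tm mu] mmin] := @tle_well u [set s | tlt le t s /\ le s u].
- by move=> s [].
- by exists u; split.
exists m => //; split=> // v tv vm; apply: tle_anti => //.
by apply: mmin; split=> //; exact: tle_trans vm mu.
Qed.

(** Both successors lie below [u], so they are comparable, and the smaller one lies between [t] and
    the other. *)
Lemma isucc_chain t s s' u : isucc t s -> isucc t s' -> le s u -> le s' u -> s = s'.
Proof.
move=> [ts Ps] [ts' Ps'] su s'u.
have [||m mss' mmin] := @tle_well u [set v | v = s \/ v = s'].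
- by move=> v [->|->].
- by exists s; left.
have ms : le m s by apply: mmin; left.
have ms' : le m s' by apply: mmin; right.
by case: mss' => mE; rewrite mE in ms ms'; [apply: Ps'|apply/esym/Ps].
Qed.

Lemma open_tree_subbase (A : set X) : tree_subbase le A -> open A.
Proof.
move=> sA; exists [set A] => [_ ->|]; last by rewrite bigcup_set1.
exact: (@finI_from1 _ _ (tree_subbase le) id).
Qed.

Lemma open_tinterval t : open (tinterval le t : set X).
Proof. by apply: open_tree_subbase; exists t; left. Qed.

(** Basic open sets are order-convex: for v <= v' <= u, membership in (0,r] passes down from [u] to
    [v'], and non-membership up from [v] to [v']. *)
Lemma nbhs_final_segment u (N : set X) : nbhs u N -> exists2 V, nbhs u V &
  forall v, V v -> le v u /\ forall v', le v v' -> le v' u -> N v'.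
Proof.
move=> uN; have [U [[D DB <-] Uu] UN] : exists2 U, open_nbhs u U & U `<=` N.
  by move: uN; rewrite nbhsE.
have [A DA Au] := Uu.
have oA : open A by exists [set A] => [_ ->|]; [exact: DB|rewrite bigcup_set1].
have uA : nbhs u (tinterval le u `&` A).
  apply: open_nbhs_nbhs; split; first by apply: openI => //; exact: open_tinterval.
  by split=> //; exact: tle_refl.
exists (tinterval le u `&` A) => // v [vu Av].
split=> // v' vv' v'u; apply: UN; exists A => //.
have [F FD AE] := DB _ DA.
suff : A v' by []; rewrite -AE => B FB.
have {}Av : B v by move: Av; rewrite -AE; exact.
have {}Au : B u by have : A u by []; rewrite -AE; exact.
have := FD _ FB; rewrite inE => -[r [BE|BE]]; rewrite BE /= in Av Au *.
  exact: tle_trans v'u Au.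
by move=> v'r; apply: Av; exact: tle_trans vv' v'r.
Qed.

(** Finitely many (0,r] with [r] in [K] cover [K], and a maximal one among these [r] is maximal in
    [K]. *)
Lemma compact_maximal (K : set X) : compact K -> K !=set0 ->
  exists2 m, K m & forall s, K s -> le m s -> s = m.
Proof.
move=> cK [a Ka].
have [l lK Kl] : exists2 l : seq X, (forall r, r \in l -> K r) &
    (forall s, K s -> exists2 r, r \in l & le s r).
  suff [l lK Kl] : exists2 l : seq X, (forall r, r \in l -> K r) &
      (forall s, (K `&` K) s -> exists2 r, r \in l & le s r).
    by exists l => // s Ks; apply: Kl.
  apply: (@compact_ideal _ K (fun A => exists2 l : seq X, (forall r, r \in l -> K r) &
      (forall s, (A `&` K) s -> exists2 r, r \in l & le s r))) => //.
  - by exists [::] => // s [].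
  - by move=> A B AB [l lK Bl]; exists l => // s [/AB Bs Ks]; exact: Bl.
  - move=> A B [l lK Al] [l' l'K Bl']; exists (l ++ l').
      by move=> r; rewrite mem_cat => /orP[/lK|/l'K].
    move=> s [[As|Bs] Ks].
      by have [|r rl sr] := Al s; [|exists r; rewrite // mem_cat rl].
    by have [|r rl sr] := Bl' s; [|exists r; rewrite // mem_cat rl orbT].
  - move=> u Ku; exists (tinterval le u).
      by apply: open_nbhs_nbhs; split; [exact: open_tinterval|exact: tle_refl].
    exists [:: u] => [r|s [su _]]; first by rewrite inE => /eqP ->.
    by exists u; rewrite ?mem_head.
have maxl (l' : seq X) : l' != [::] ->
    exists2 m, m \in l' & forall s, s \in l' -> le m s -> s = m.
  elim: l' => [//|b l' IH] _; have [->|l'0] := eqVneq l' [::].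
    by exists b => [|s]; rewrite inE // => /eqP.
  have [m ml mmax] := IH l'0.
  have [mb|nmb] := pselect (le m b); last first.
    exists m => [|s]; first by rewrite inE ml orbT.
    by rewrite inE => /predU1P[->//|/mmax].
  exists b => [|s]; first by rewrite mem_head.
  rewrite inE => /predU1P[//|sl bs].
  have sm : s = m by apply: mmax => //; exact: tle_trans mb bs.
  by rewrite sm in bs *; exact: tle_anti.
have [|m ml mmax] := maxl l.
  by have [r rl _] := Kl a Ka; apply: contraTneq rl => ->.
exists m => [|s Ks ms]; first exact: lK.
have [r rl sr] := Kl s Ks.
have rm : r = m by apply: mmax => //; exact: tle_trans ms sr.
by rewrite rm in sr; exact: tle_anti.
Qed.

(** The neighbourhood (0,u] contains at most one successor of [t] by [isucc_chain], and the level
    set is compact. *)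
Lemma C0_finite_isucc x (c : R) t : @C0 R T le x -> 0 < c ->
  finite_set [set s | isucc t s /\ c <= `|x s|].
Proof.
move=> [_ /(_ c) cK] c0; have {}cK := cK c0.
have : finite_set ([set s | c <= `|x s|] `&` [set s | isucc t s]).
  apply: compact_finite_set => // u _; exists (tinterval le u).
    by apply: open_nbhs_nbhs; split; [exact: open_tinterval|exact: tle_refl].
  by apply: finite_subsingleton => s s' [su ts] [s'u ts']; exact: isucc_chain ts ts' su s'u.
by apply: sub_finite_set => s [].
Qed.

Lemma continuous_sqr x : continuous x -> continuous (fun v => x v ^+ 2).
Proof. by move=> xc v; exact: (cvgM (xc v) (xc v)). Qed.

Lemma continuous_abs x : continuous x -> continuous (fun v => `|x v|).
Proof. by move=> xc v; exact: (cvg_norm (xc v)). Qed.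

(** Near [u], any v < u has a successor [s] with s <= u. By continuity the squares at [v] and [s]
    are both within [gam / 2] of the one at [u], which excludes a drop of [gam]. So near [u] only
    [u] itself can qualify. *)
Lemma C0_finite_drop x (c gam : R) : @C0 R T le x -> 0 < c -> 0 < gam ->
  finite_set [set t | c <= `|x t| /\ forall s, isucc t s -> x s ^+ 2 + gam <= x t ^+ 2].
Proof.
move=> [xcont /(_ c) cK] c0 gam0; have {}cK := cK c0.
pose S := [set t | forall s, isucc t s -> x s ^+ 2 + gam <= x t ^+ 2].
apply: (@compact_finite_set _ _ S cK) => u _.
have x2 : x v ^+ 2 @[v --> u] --> x u ^+ 2 by exact: continuous_sqr.
have g2 : 0 < gam / 2 by rewrite divr_gt0.
have /cvgrPdist_lt/(_ _ g2)/nbhs_final_segment[V Vu VP] := x2.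
exists V => //; apply: (sub_finite_set _ (finite_set1 u)) => v [Vv Sv] /=.
have [vu vV] := VP v Vv; apply: contrapT => vneu.
have [s vs su] : exists2 s, isucc v s & le s u by apply: isucc_exists; split.
have /= h1 := vV _ (tle_refl v) vu.
have /= h2 : `|x u ^+ 2 - x s ^+ 2| < gam / 2 by apply: vV => //; case: vs => -[].
have := Sv _ vs; move: h1 h2; rewrite !ltr_norml => /andP[? ?] /andP[? ?]; lra.
Qed.

(** * Boundedness and linear structure of [C0] *)

Lemma C0_bounded x : @C0 R T le x -> exists M : R, forall t, `|x t| <= M.
Proof.
move=> [xcont /(_ 1 ltr01) cK].
have [[a Ka]|K0] := pselect ([set t | 1 <= `|x t|] !=set0); last first.
  exists 1 => t; rewrite leNgt; apply/negP => h; apply: K0; exists t.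
  by rewrite /= ltW.
have [||m _ mmax] := @compact_EVT_max _ R (fun t => `|x t|) _ _ cK.
- by exists a.
- by apply: continuous_subspaceT; exact: continuous_abs.
exists (Num.max 1 `|x m|) => t; have [h|h] := leP 1 `|x t|.
  by rewrite le_max mmax ?orbT// inE.
by rewrite le_max ltW.
Qed.

Lemma le_supnorm x : @C0 R T le x -> forall t, `|x t| <= supnorm x.
Proof.
move=> /C0_bounded[M xM] t; apply: ub_le_sup; last by exists t.
by exists M => _ [s _ <-].
Qed.

(** The square attains its maximum on the compact set |x| >= 1/2 and is at most 1/2 elsewhere. *)
Lemma C0_uniform_lt1 x : @C0 R T le x -> (forall t, x t ^+ 2 < 1) ->
  exists2 rho : R, 0 < rho < 1 & forall t, x t ^+ 2 <= rho.
Proof.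
move=> [xcont /(_ 2^-1) cK] x1.
have {}cK : compact [set t | 2^-1 <= `|x t|] by apply: cK; rewrite invr_gt0.
have half t : ~ (2^-1 <= `|x t|) -> x t ^+ 2 <= 2^-1.
  move=> /negP; rewrite -ltNge => h.
  by rewrite -real_normK ?num_real// expr2; have := normr_ge0 (x t); nra.
have [[a Ka]|K0] := pselect ([set t | 2^-1 <= `|x t|] !=set0); last first.
  exists 2^-1 => [|t]; first by apply/andP; split; lra.
  by apply: half => h; apply: K0; exists t.
have [||m _ mmax] := @compact_EVT_max _ R (fun t => x t ^+ 2) _ _ cK.
- by exists a.
- by apply: continuous_subspaceT; exact: continuous_sqr.
exists (Num.max 2^-1 (x m ^+ 2)) => [|t].
  by rewrite lt_max gt_max x1 andbT invr_gt0 ltr0n/=; lra.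
have [h|h] := pselect (2^-1 <= `|x t|).
  by rewrite le_max mmax ?orbT// inE.
by rewrite le_max half.
Qed.

Lemma C0D x y : @C0 R T le x -> @C0 R T le y -> @C0 R T le (fadd x y).
Proof.
move=> [xc xK] [yc yK].
have xyc : continuous (fadd x y : X -> R) by move=> t; exact: (cvgD (xc t) (yc t)).
split=> // e e0; have e20 : 0 < e / 2 by rewrite divr_gt0.
apply: (subclosed_compact _ (compactU (xK _ e20) (yK _ e20))).
  rewrite (_ : [set t | _] = (fun t => `|fadd x y t|) @^-1` [set r | e <= r])//.
  apply: closed_comp; last exact: closed_ge.
  by move=> t _; exact: continuous_abs.
move=> t /= exy; have [?|?] := leP (e / 2) `|x t|; first by left.
right; rewrite /=; have := ler_normD (x t) (y t); rewrite /fadd in exy; lra.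
Qed.

Lemma C0Z (a : R) x : @C0 R T le x -> @C0 R T le (fscale a x).
Proof.
move=> [xc xK]; split; first by move=> t; exact: (cvgM (cvg_cst a) (xc t)).
move=> e e0; have [->|a0] := eqVneq a 0.
  rewrite (_ : [set t | _] = set0); first exact: compact0.
  by rewrite -subset0 => t /=; rewrite /fscale mul0r normr0 leNgt e0.
have na : 0 < `|a| by rewrite normr_gt0.
rewrite (_ : [set t | _] = [set t | e / `|a| <= `|x t|]); first exact/xK/divr_gt0.
by apply/seteqP; split=> t /=; rewrite /fscale normrM ler_pdivrMr// mulrC.
Qed.

Lemma C0_0 : @C0 R T le (fun=> 0).
Proof.
split; first exact: cst_continuous.
move=> e e0; rewrite (_ : [set t | _] = set0); first exact: compact0.
by rewrite -subset0 => t /=; rewrite normr0 leNgt e0.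
Qed.

(** * The bump function *)

(** Normalised so that [K * flat 0 u >= 1] as soon as [u >= 1]. *)
Let K : R := (flat 0 1)^-1.
Let K_gt0 : 0 < K. Proof. by rewrite invr_gt0 flat0_gt0. Qed.

(* Meaningful for [u ^+ 2 < 1] only. *)
Definition weight (u : R) : R := (1 - u ^+ 2)^-1.
Definition branch_cost (u : R) : R := K * (weight u * flat 0 (weight u - 2)).
Definition total_cost x t : R := \sum_(s \in [set s | isucc t s]) branch_cost (x s).
Definition activity x t : R := flat 0 (weight (x t) - 4 - total_cost x t).
(* The sum is genuine only on the unit ball: [\sum_(_ \in _)] is [0] when the
   support is infinite. *)
Definition bump x : R :=
  if `[< forall t, x t ^+ 2 < 1 >] then flat 0 (1 - K * \sum_(t \in [set: X]) activity x t)
  else 0.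

(** * Estimates for weights and branch costs *)

Lemma weight_gt0 (u : R) : u ^+ 2 < 1 -> 0 < weight u.
Proof. by move=> u1; rewrite invr_gt0 subr_gt0. Qed.

Lemma weight_le (u a : R) : u ^+ 2 <= a -> a < 1 -> weight u <= (1 - a)^-1.
Proof.
by move=> ua a1; rewrite lef_pV2 ?posrE ?subr_gt0 ?(le_lt_trans ua)// lerB.
Qed.

Lemma weight_ge (u a : R) : a <= u ^+ 2 -> u ^+ 2 < 1 -> (1 - a)^-1 <= weight u.
Proof.
by move=> au u1; rewrite lef_pV2 ?posrE ?subr_gt0 ?(le_lt_trans au)// lerB.
Qed.

Lemma branch_cost_ge0 (u : R) : u ^+ 2 < 1 -> 0 <= branch_cost u.
Proof.
move=> u1; rewrite /branch_cost mulr_ge0 ?(ltW K_gt0)//.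
by rewrite mulr_ge0 ?flat_ge0// ltW ?weight_gt0.
Qed.

(** Once the weight reaches 3, the flat factor times [K] is at least 1 and the cost is at least the
    weight; below 3 the left side is negative. *)
Lemma branch_cost_ge (u : R) : u ^+ 2 < 1 -> weight u - 3 <= branch_cost u.
Proof.
move=> u1; have [w3|w3] := leP 3 (weight u); last first.
  by rewrite (le_trans _ (branch_cost_ge0 u1))// subr_le0 ltW.
rewrite (@le_trans _ _ (weight u))//; first by rewrite lerBlDr lerDl.
rewrite /branch_cost mulrCA ler_peMr ?(ltW (weight_gt0 u1))//.
rewrite mulrC ler_pdivlMr ?flat0_gt0// mul1r flat0_le//.
lra.
Qed.

(** Here the weight is at most 2, where the flat factor vanishes. This makes [total_cost] a finite
    sum for [x] in [C0]. *)
Lemma branch_cost_eq0 (u : R) : u ^+ 2 <= 2^-1 -> branch_cost u = 0.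
Proof.
move=> u2; rewrite /branch_cost flat_le0 ?mulr0// subr_le0.
have half : (1 - 2^-1)^-1 = 2 :> R by field.
by rewrite -half weight_le// -half; lra.
Qed.

Lemma branch_cost_le (u a : R) : u ^+ 2 <= a -> a < 1 -> branch_cost u <= K * (1 - a)^-1.
Proof.
move=> ua a1; rewrite /branch_cost ler_wpM2l ?(ltW K_gt0)//.
apply: le_trans (weight_le ua a1); rewrite ler_piMr ?flat0_le1//.
exact/ltW/weight_gt0/le_lt_trans/a1.
Qed.

(** With A, B the squares of [u], [v], clearing denominators gives A - B > (1 - A)(1 - B) >= (1 -
    a)^2. *)
Lemma weight_gap (u v a : R) : weight v + 1 < weight u -> u ^+ 2 <= a -> v ^+ 2 <= a ->
  a < 1 -> v ^+ 2 + (1 - a) ^+ 2 <= u ^+ 2.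
Proof.
rewrite /weight; move: (u ^+ 2) (v ^+ 2) => A B + Aa Ba a1.
have A0 : 0 < 1 - A by lra.
have B0 : 0 < 1 - B by lra.
rewrite -(ltr_pM2r (mulr_gt0 A0 B0)) mulrDl mul1r.
rewrite [_ * ((1 - A) * _)]mulrCA mulVf ?gt_eqF// mulr1 mulrA mulVf ?gt_eqF// mul1r.
nra.
Qed.

(** Used to replace sums over all nodes or successors by sums over one list, fixed while the
    function [y] varies near [x]. *)
Lemma fsum_seq (Y : choiceType) (A : set Y) (l : seq Y) (f : Y -> R) :
  uniq l -> (forall i, i \in l -> A i) -> (forall i, A i -> i \notin l -> f i = 0) ->
  \sum_(i \in A) f i = \sum_(i <- l) f i.
Proof.
move=> ul lA f0; rewrite (fsbigE l)// big_seq_cond [RHS]big_seq.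
by apply: eq_bigl => i; rewrite andb_idr// => /lA; rewrite inE.
Qed.

Lemma finite_set_uniq_seq (Y : choiceType) (A : set Y) :
  finite_set A -> exists2 l : seq Y, uniq l & forall i, A i <-> i \in l.
Proof.
move=> /finite_seqP[l ->]; exists (undup l); first exact: undup_uniq.
by move=> i; rewrite mem_undup.
Qed.

(** * Costs and activities on the unit ball *)

Lemma isucc_seq x (c : R) t : @C0 R T le x -> 0 < c -> exists2 l : seq X, uniq l &
  (forall s, s \in l -> isucc t s) /\ (forall s, isucc t s -> s \notin l -> `|x s| < c).
Proof.
move=> Cx c0; have [l ul lP] := finite_set_uniq_seq (C0_finite_isucc t Cx c0).
exists l => //; split=> [s /lP[]//|s ts snl].
by rewrite ltNge; apply: contra snl => cx; apply/lP.
Qed.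

Lemma sqr_le_half (u : R) : `|u| < 2^-1 -> u ^+ 2 <= 2^-1.
Proof. by rewrite ltr_norml => /andP[? ?]; nra. Qed.

Lemma branch_cost_le_total x s t : @C0 R T le x -> (forall t, x t ^+ 2 < 1) ->
  isucc t s -> branch_cost (x s) <= total_cost x t.
Proof.
move=> Cx x1 ts; have [|l ul [lt lx]] := @isucc_seq x 2^-1 t Cx; first by rewrite invr_gt0.
rewrite /total_cost (fsum_seq ul)// => [|i ti il]; last first.
  by rewrite branch_cost_eq0// sqr_le_half// lx.
have [sl|snl] := boolP (s \in l).
  by rewrite (big_rem _ sl)/= lerDl sumr_ge0// => i _; rewrite branch_cost_ge0.
by rewrite branch_cost_eq0 ?sqr_le_half ?lx// sumr_ge0// => i _; rewrite branch_cost_ge0.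
Qed.

Lemma total_cost_ge0 x t : (forall t, x t ^+ 2 < 1) -> 0 <= total_cost x t.
Proof. by move=> x1; apply: fsumr_ge0 => s _; exact: branch_cost_ge0. Qed.

(** A positive argument of [flat] forces weight above 4 = 1/(1 - 3/4). It also forces the weight at
    [t] above 4 plus the cost of [s], hence by [branch_cost_ge] above the weight at [s] plus 1, and
    [weight_gap] applies. *)
Lemma activity_neq0 x t (a : R) : @C0 R T le x -> (forall t, x t ^+ 2 <= a) -> a < 1 ->
  activity x t != 0 ->
  3 / 4 <= x t ^+ 2 /\ forall s, isucc t s -> x s ^+ 2 + (1 - a) ^+ 2 <= x t ^+ 2.
Proof.
move=> Cx xa a1 act; have x1 s : x s ^+ 2 < 1 by exact: le_lt_trans (xa s) a1.
have pos : 0 < weight (x t) - 4 - total_cost x t.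
  by rewrite ltNge; apply: contra act => h; rewrite /activity flat_le0.
split=> [|s ts].
  have := total_cost_ge0 t x1; have [//|small] := leP (3 / 4) (x t ^+ 2).
  have := weight_le (ltW small) _; rewrite (_ : (1 - 3 / 4)^-1 = 4); last by field.
  move=> /(_ _); have h : (3 / 4 : R) < 1 by lra.
  by move=> /(_ h); lra.
apply: weight_gap => //; have := branch_cost_ge (x1 s); have := branch_cost_le_total Cx x1 ts.
lra.
Qed.

Lemma finite_activity x : @C0 R T le x -> (forall t, x t ^+ 2 < 1) ->
  finite_set [set t | activity x t != 0].
Proof.
move=> Cx x1; have [a /andP[a0 a1] xa] := C0_uniform_lt1 Cx x1.
have : finite_set [set t | 2^-1 <= `|x t| /\
    forall s, isucc t s -> x s ^+ 2 + (1 - a) ^+ 2 <= x t ^+ 2].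
  by apply: C0_finite_drop => //; rewrite ?invr_gt0// exprn_gt0// subr_gt0.
apply: sub_finite_set => t /(activity_neq0 Cx xa a1)[x34 xs]; split=> //.
rewrite leNgt; apply/negP => /sqr_le_half; lra.
Qed.

(** The terms are nonnegative, and [finite_activity] ensures that the sum is not the default 0. *)
Lemma activity_le_sum x t : @C0 R T le x -> (forall t, x t ^+ 2 < 1) ->
  activity x t <= \sum_(t \in [set: X]) activity x t.
Proof.
move=> Cx x1; have [l ul lP] := finite_set_uniq_seq (finite_activity Cx x1).
rewrite (fsum_seq ul)// => [|i _ il]; last first.
  by apply: contraNeq il => act; apply/lP.
have [tl|tnl] := boolP (t \in l).
  by rewrite (big_rem _ tl)/= lerDl sumr_ge0// => i _; exact: flat_ge0.
have -> : activity x t = 0 by apply: contraNeq tnl => act; apply/lP.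
by rewrite sumr_ge0// => i _; exact: flat_ge0.
Qed.

(** * The bump near points outside the open unit ball *)

Lemma sqr_ge1 (u : R) : (1 <= u ^+ 2) = (1 <= `|u|).
Proof. by rewrite -[u ^+ 2]real_normK ?num_real// expr_ge1. Qed.

Lemma norm_le1 (u : R) : u ^+ 2 < 1 -> `|u| <= 1.
Proof. by rewrite ltNge sqr_ge1 -ltNge => /ltW. Qed.

Lemma sqr_perturb (u v r : R) : `|v| <= 1 -> `|u - v| <= r -> r <= 8^-1 ->
  `|u ^+ 2 - v ^+ 2| <= 3 * r.
Proof.
move=> v1 uv r8; rewrite subr_sqr normrM mulrC.
have uvE : u + v = (u - v) + (v + v) by ring.
apply: ler_pM => //; rewrite uvE (le_trans (ler_normD _ _))//.
have := ler_normD v v; lra.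
Qed.

Lemma bump_eq0_near x t : @C0 R T le x -> 1 <= x t ^+ 2 ->
  (forall s, isucc t s -> x s ^+ 2 < 1) ->
  exists2 d : R, 0 < d & forall y r, @C0 R T le y -> r < d ->
    (forall t, `|y t - x t| <= r) -> bump y = 0.
Proof.
(* Successors off [l] have |x s| < 1/4, hence |y s| < 1/4 + 1/8 < 1/2, and cost nothing. *)
move=> Cx xt xs; have [|l ul [lt lx]] := @isucc_seq x 4^-1 t Cx; first by rewrite invr_gt0.
have [a a01 la] : exists2 a : R, 0 <= a < 1 & forall s, s \in l -> x s ^+ 2 <= a.
  have : forall s, s \in l -> x s ^+ 2 < 1 by move=> s /lt /xs.
  elim: (l) => [|s l' IH] l'1; first by exists 0; rewrite ?lexx ?ltr01.
  have [|a /andP[a0 a1] aP] := IH; first by move=> u ul'; apply: l'1; rewrite inE ul' orbT.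
  exists (Num.max a (x s ^+ 2)) => [|u].
    by rewrite le_max a0 gt_max a1 l'1 ?mem_head.
  by rewrite inE le_max => /predU1P[->|/aP ->//]; rewrite lexx orbT.
have /andP[a0 a1] := a01.
(* Half of the gap [1 - a] is left for moving from [x] to [y]; [H] will bound the total cost of [y]
   at [t]. *)
pose b := (1 + a) / 2; have b1 : b < 1 by rewrite /b; lra.
pose H := (size l)%:R * (K * (1 - b)^-1).
have H0 : 0 <= H.
  by rewrite !mulr_ge0 ?(ltW K_gt0)// invr_ge0 subr_ge0 ltW.
(* The term [(1 - a) / 6] gives a + 3r <= b on [l]. The last term makes the weight of [y t] at least
   [H + 5], so the argument of the activity is at least (H + 5) - 4 - H = 1. *)
pose d := Num.min (Num.min 8^-1 ((1 - a) / 6)) (2 * (H + 5))^-1.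
have d0 : 0 < d.
  by rewrite /d !lt_min !invr_gt0 ?divr_gt0//; lra.
exists d => // y r Cy; rewrite /d !lt_min => /andP[/andP[r8 ra] rH] yx.
rewrite /bump; case: asboolP => // y1.
apply: flat_le0; rewrite subr_le0 mulrC ler_pdivlMr ?flat0_gt0// mul1r.
apply: le_trans (activity_le_sum t Cy y1); apply: flat0_le.
have r0 : 0 <= r by exact: le_trans (yx t).
have yt : 1 - 2 * r <= y t ^+ 2.
  have xt1 : 1 <= `|x t| by rewrite -sqr_ge1.
  have yt1 : 1 - r <= `|y t|.
    have := ler_normB (y t) (y t - x t); rewrite opprB addrC subrK => h.
    by have := yx t; lra.
  rewrite -[y t ^+ 2]real_normK ?num_real//; nra.
have wt : H + 5 <= weight (y t).
  apply: le_trans (weight_ge yt (y1 t)).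
  have -> : 1 - (1 - 2 * r) = 2 * r by ring.
  (* The case [r = 0] would put [y] outside the ball; excluding it makes 1/(2r) meaningful. *)
  have [r0'|r0'] := eqVneq r 0; first by have := y1 t; rewrite r0' in yt; lra.
  have rp : 0 < r by rewrite lt_def r0'.
  rewrite -[H + 5]invrK lef_pV2 ?posrE ?invr_gt0; [|lra|lra].
  move: rH; rewrite invfM; lra.
suff : total_cost y t <= H by lra.
rewrite /total_cost (fsum_seq ul)// => [|s ts snl]; last first.
  apply: branch_cost_eq0; apply: sqr_le_half.
  have -> : y s = (y s - x s) + x s by ring.
  rewrite (le_lt_trans (ler_normD _ _))//.
  by have := lx s ts snl; have := yx s; lra.
apply: (@le_trans _ _ (\sum_(s <- l) K * (1 - b)^-1)); last first.
  by rewrite big_const_seq count_predT iter_addr_0 -mulr_natl.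
rewrite big_seq [leRHS]big_seq ler_sum// => s sl.
apply: branch_cost_le => //.
have xs1 : `|x s| <= 1 by exact/norm_le1/xs/lt.
have := sqr_perturb xs1 (yx s) (ltW r8); rewrite ler_norml => /andP[_].
by have := la _ sl; rewrite /b; lra.
Qed.

(** * Formulas for the bump inside the ball *)

Definition weight_expr t : expr R X :=
  Inv (Add (Cst _ 1) (Mul (Cst _ (- 1)) (Mul (Coord _ t) (Coord _ t)))).
Definition sum_expr (f : X -> expr R X) (l : seq X) : expr R X :=
  foldr (fun s e => Add (f s) e) (Cst _ 0) l.
Definition branch_cost_expr s : expr R X :=
  Mul (Cst _ K) (Mul (weight_expr s) (Flat 0 (Add (weight_expr s) (Cst _ (- 2))))).
Definition activity_expr (l : seq X) t : expr R X :=
  Flat 0 (Add (Add (weight_expr t) (Cst _ (- 4)))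
    (Mul (Cst _ (- 1)) (sum_expr branch_cost_expr l))).
Definition bump_expr (l : seq X) (L : X -> seq X) : expr R X :=
  Flat 0 (Add (Cst _ 1) (Mul (Cst _ (- K)) (sum_expr (fun t => activity_expr (L t) t) l))).

Lemma ev_sum_expr y f l : ev y (sum_expr f l) = \sum_(s <- l) ev y (f s).
Proof. by elim: l => [|s l IH] /=; rewrite ?big_nil// big_cons IH. Qed.

Lemma defined_sum_expr y f l : (forall s, defined_at y (f s)) -> defined_at y (sum_expr f l).
Proof. by move=> fP; elim: l => //= s l ->; rewrite fP. Qed.

Lemma ev_weight_expr y t : ev y (weight_expr t) = weight (y t).
Proof. by rewrite /= /weight expr2 mulN1r. Qed.

Lemma ev_activity_expr y l t : ev y (activity_expr l t) =
  flat 0 (weight (y t) - 4 - \sum_(s <- l) branch_cost (y s)).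
Proof.
rewrite -[LHS]/(flat 0 (ev y (weight_expr t) - 4 + -1 * ev y (sum_expr branch_cost_expr l))).
rewrite ev_weight_expr ev_sum_expr mulN1r (eq_bigr (fun s => branch_cost (y s)))// => s _.
by rewrite /branch_cost -ev_weight_expr.
Qed.

Lemma defined_bump_expr y l L : (forall t, y t ^+ 2 < 1) -> defined_at y (bump_expr l L).
Proof.
move=> y1; have wP t : defined_at y (weight_expr t).
  by rewrite /= mulN1r -expr2 subr_eq0 andbT gt_eqF.
rewrite /= defined_sum_expr// => t.
rewrite /activity_expr [defined_at _ _]/= -/(weight_expr t).
have := wP t; rewrite /= => ->; rewrite /= defined_sum_expr// => s.
by have := wP s; rewrite /= => ->.
Qed.

(** The list [l] of possibly active nodes and the lists [L t] of successors of possibly nonzero cost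
    depend on [x] only and serve every [y] within [d], so one formula covers them all. *)
Lemma bump_formula_near x : @C0 R T le x -> (forall t, x t ^+ 2 < 1) ->
  exists d e, 0 < d /\ formula_near (@C0 R T le) bump x d e.
Proof.
move=> Cx x1; have [a /andP[a0 a1] xa] := C0_uniform_lt1 Cx x1.
pose b := (1 + a) / 2; have b1 : b < 1 by rewrite /b; lra.
pose gam := (1 - b) ^+ 2; have gam0 : 0 < gam by rewrite exprn_gt0// subr_gt0.
have fin : finite_set [set t | 2^-1 <= `|x t| /\
    forall s, isucc t s -> x s ^+ 2 + gam / 4 <= x t ^+ 2].
  by apply: C0_finite_drop => //; rewrite ?invr_gt0// divr_gt0.
have [l ul lP] := finite_set_uniq_seq fin.
have /choice[L LP] : forall t, exists L : seq X, uniq L /\ (forall s, s \in L -> isucc t s) /\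
    (forall s, isucc t s -> s \notin L -> `|x s| < 4^-1).
  by move=> t; have [|L uL LP] := @isucc_seq x 4^-1 t Cx; [rewrite invr_gt0|exists L].
(* The squares at [t] and at [s] each move by at most 3r < 3 gam / 8, so a drop of [gam] for [y]
   leaves a drop of [gam / 4] for [x], as required in [fin]. *)
pose d := Num.min (Num.min 8^-1 ((1 - a) / 6)) (gam / 8).
have d0 : 0 < d by rewrite /d !lt_min !divr_gt0 ?invr_gt0//; lra.
exists d, (bump_expr l L); split=> // y r Cy; rewrite /d !lt_min => /andP[/andP[r8 ra] rg] yx.
have x_le1 t : `|x t| <= 1 by exact: norm_le1.
have y2 t : `|y t ^+ 2 - x t ^+ 2| <= 3 * r by exact: sqr_perturb (ltW r8).
have yb t : y t ^+ 2 <= b.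
  by have := y2 t; have := xa t; rewrite ler_norml /b => ? /andP[_]; lra.
have y1 t : y t ^+ 2 < 1 by exact: le_lt_trans (yb t) b1.
split; first exact: defined_bump_expr.
rewrite /bump asboolT// [ev _ _]/= ev_sum_expr mulNr.
rewrite (fsum_seq ul)// => [|t _]; last first.
  apply: contraNeq => /(activity_neq0 Cy yb b1)[y34 ys]; apply/lP; split=> [|s ts].
    (* The square at [t] is at least 3/4 for [y], hence at least 3/8 for [x], which exceeds 1/4. *)
    rewrite leNgt; apply/negP; rewrite ltr_norml => /andP[? ?].
    by have := y2 t; rewrite ler_norml => /andP[? ?]; nra.
  have := ys s ts; have := y2 t; have := y2 s; rewrite -/gam.
  by rewrite !ler_norml => /andP[? ?] /andP[? ?]; lra.
congr (flat 0 (_ - _ * _)); apply: eq_bigr => t _; rewrite ev_activity_expr.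
have [uL [Lt Lx]] := LP t.
rewrite /activity /total_cost (fsum_seq uL)// => s ts snL.
apply: branch_cost_eq0; apply: sqr_le_half.
have -> : y s = (y s - x s) + x s by ring.
rewrite (le_lt_trans (ler_normD _ _))//.
by have := Lx s ts snL; have := yx s; lra.
Qed.

(** * Smoothness, non-triviality and support *)

Lemma bump_smooth : smooth_on (@C0 R T le) bump.
Proof.
apply: smooth_on_local_formula; [exact: le_supnorm|exact: C0D|exact: C0Z|].
move=> x Cx; have [x1|] := pselect (forall t, x t ^+ 2 < 1).
  exact: bump_formula_near.
move=> /existsNP[t0 /negP]; rewrite -leNgt => xt0.
have [t xt xs] : exists2 t, 1 <= x t ^+ 2 & forall s, isucc t s -> x s ^+ 2 < 1.
  have [|t tK tmax] := compact_maximal (Cx.2 1 ltr01); first by exists t0; rewrite /= -sqr_ge1.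
  exists t => [|s [[ts tns] _]]; first by rewrite sqr_ge1.
  by rewrite ltNge sqr_ge1; apply/negP => /tmax/(_ ts) st; exact/tns/esym.
have [d d0 dP] := bump_eq0_near Cx xt xs.
by exists d, (Cst _ 0); split=> // y r Cy rd yx; split=> //; exact: dP Cy rd yx.
Qed.

Lemma bump_0 : bump (fun=> 0) != 0.
Proof.
rewrite /bump asboolT => [|t]; last by rewrite expr0n.
rewrite fsbig1 => [|t _]; first by rewrite mulr0 subr0 gt_eqF// flat0_gt0.
rewrite /activity /total_cost fsbig1 => [|s _].
  have w0 : weight 0 = 1 by rewrite /weight expr0n/= subr0 invr1.
  by rewrite flat_le0// w0; lra.
by rewrite branch_cost_eq0// expr0n/= invr_ge0.
Qed.

Lemma bump_bounded_support x : bump x != 0 -> supnorm x <= 1.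
Proof.
rewrite /bump; case: asboolP => [x1 _|_]; last by rewrite eqxx.
have x_le1 t : `|x t| <= 1 by exact: norm_le1.
have [N0|N0] := pselect ([set `|x t| | t in [set: X]] !=set0).
  by apply: ge_sup => // _ [t _ <-].
(* On the empty tree the supremum of the empty set is 0. *)
rewrite /supnorm (_ : [set _ | _ in _] = set0) ?sup0// -subset0 => r xr.
by apply: N0; exists r.
Qed.

End Trees.

Theorem theorem9p3 (R : realType) (T : Type) (le : T -> T -> Prop) :
  is_tree le -> exists phi : (tree_top le -> R) -> R, smooth_bump phi.
Proof.
move=> tree_le; exists (@bump R T le); split.
- exact: bump_smooth.
- by exists (fun=> 0); split; [exact: C0_0|exact: bump_0].
- by exists 1 => x _; exact: bump_bounded_support.
Qed.
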